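(* The family of steady paths grows according to the following succession rule: \[\Omega_{steady}=\left\{\begin{array}{l}(0,2)\\ (h,k)\rightsquigarrow (h+k-1,2),\ldots,(h+1,k),\ (0,k+1),\ldots,(0,h+k+1).\end{array}\right.\]
   Context: A steady path of size $n\ge1$ is a lattice path $P$ confined to the cone $\mathfrak{C}=\{(x,y)\in\mathbb{N}^2: y\le x\}$, using steps $U=(1,1)$, $D=(1,-1)$ and $W=(-1,1)$, without any factor (pair of consecutive steps) $WD$ or $DW$, starting at $(0,0)$ and ending at $(2n,0)$, such that: (S1) for any factor $UU$, the suffix of $P$ following this $UU$ factor lies weakly below the line parallel to $y=x$ passing through the $UU$ factor; (S2) for any factor $WU$, the suffix of $P$ following this $WU$ factor lies weakly below the line parallel to $y=x$ passing through the up step $U$ of the $WU$ factor. A generating tree for a combinatorial class $\mathcal{C}$ (with finitely many objects of each size and exactly one object of size $1$) is an infinite rooted tree whose vertices are the objects of $\mathcal{C}$, each appearing exactly once, with objects of size $n$ at level $n$ (the root being at level $1$); the children of an object $c$ are obtained by adding to $c$ an atom (a piece of object increasing the size by $1$) following some prescribed rules. A succession rule consists of a starting label (the axiom) and, for each label, a multiset of produced labels (its productions). The class $\mathcal{C}$ grows according to a succession rule $\Omega$ if there are a generating tree for $\mathcal{C}$ and an assignment of labels to the objects of $\mathcal{C}$ such that the root carries the axiom and, for each object with label $\ell$, the multiset of labels of its children is exactly the multiset of productions of $\ell$ in $\Omega$. In the rule above, the axiom is $(0,2)$ and label $(h,k)$ produces $(h+k+1-i,i)$ once for each $2\le i\le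 k$, and $(0,i)$ once for each $k+1\le i\le h+k+1$. *)

(* Defs.v *)
From HB Require Import structures.
From mathcomp Require Import all_boot all_order all_algebra.

Set Implicit Arguments.
Unset Strict Implicit.
Unset Printing Implicit Defensive.

Import GRing.Theory.

Inductive step := U | D | W.

Definition step_code (s : step) : option bool :=
  match s with U => None | D => Some false | W => Some true end.
Definition step_decode (o : option bool) : step :=
  match o with None => U | Some false => D | Some true => W end.
Lemma step_codeK : cancel step_code step_decode.
Proof. by case. Qed.
HB.instance Definition _ := Finite.copy step (can_type step_codeK).

Definition step_vec (s : step) : int * int :=
  match s with
  | U => (1, 1)%R
  | D => (1, -1)%R
  | W => (-1, 1)%R
  end.

(* A path starting at (0,0) is encoded by its sequence of steps. *)
Definition endpoint (p : seq step) : int * int :=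
  (\sum_(s <- p) step_vec s)%R.

Definition in_cone (z : int * int) : bool :=
  [&& 0 <= z.1, 0 <= z.2 & z.2 <= z.1]%R.

(* The cone and the half-planes below a line are convex, so it is enough to   *)
(* test the lattice points that a path visits.                                *)
Definition confined (p : seq step) : Prop :=
  forall q, prefix q p -> in_cone (endpoint q).

(* The index c of the line y = x + c containing z. *)
Definition diag (z : int * int) : int := (z.2 - z.1)%R.

(* The continuation b of the path a lies weakly below the line parallel to    *)
(* y = x passing through z.                                                   *)
Definition suffix_below (z : int * int) (a b : seq step) : Prop :=
  forall q, prefix q b -> (diag (endpoint (a ++ q)) <= diag z)%R.

Definition S1 (p : seq step) : Prop :=
  forall a b, p = a ++ [:: U; U] ++ b ->
    suffix_below (endpoint a) (a ++ [:: U; U]) b.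

Definition S2 (p : seq step) : Prop :=
  forall a b, p = a ++ [:: W; U] ++ b ->
    suffix_below (endpoint (a ++ [:: W])) (a ++ [:: W; U]) b.

Record steady_path (n : nat) (p : seq step) : Prop := SteadyPath {
  steady_size_gt0 : 0 < n;
  steady_end : endpoint p = (n.*2%:Z, 0)%R;
  steady_confined : confined p;
  steady_noWD : ~~ infix [:: W; D] p;
  steady_noDW : ~~ infix [:: D; W] p;
  steady_S1 : S1 p;
  steady_S2 : S2 p
}.

(* A class is given by C : nat -> T -> Prop, where C n c means that c is an   *)
(* object of size n.                                                          *)
Record combinatorial_class (T : eqType) (C : nat -> T -> Prop) : Prop :=
  CombinatorialClass {
    class_size_gt0 : forall n c, C n c -> 0 < n;
    class_size_inj : forall m n c, C m c -> C n c -> m = n;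
    class_finite : forall n, exists s : seq T, forall c, C n c -> c \in s;
    class_one : exists! c, C 1 c
  }.

(* adds_atom c d : the object d results from adding a piece to c.             *)
(* As a child is one unit larger than its parent, gtree_parent makes the      *)
(* vertices of level n (the root being at level 1) the objects of size n.     *)
Record generating_tree (T : eqType) (C : nat -> T -> Prop)
    (adds_atom : T -> T -> Prop) (root : T) (children : T -> seq T) : Prop :=
  GeneratingTree {
    gtree_infinite : forall n, exists m c, n <= m /\ C m c;
    gtree_root : C 1 root;
    gtree_uniq : forall n c, C n c -> uniq (children c);
    gtree_child : forall n c d, C n c -> d \in children c ->
      C n.+1 d /\ adds_atom c d;
    gtree_parent : forall n d, C n d -> d <> root ->
      exists! c, (exists m, C m c) /\ d \in children c
  }.

(* Productions are listed with multiplicity; their order is irrelevant. *)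
Record succession_rule (L : eqType) := SuccessionRule {
  start : L;
  productions : L -> seq L
}.

Definition grows_according_to (T : eqType) (C : nat -> T -> Prop)
    (adds_atom : T -> T -> Prop) (L : eqType) (Omega : succession_rule L) :
    Prop :=
  combinatorial_class C /\
  exists (root : T) (children : T -> seq T) (label : T -> L),
    [/\ generating_tree C adds_atom root children,
        label root = start Omega &
        forall n c, C n c ->
          perm_eq [seq label d | d <- children c]
                  (productions Omega (label c))].

(* For paths, a piece is a factor inserted at some point of the path. *)
Definition inserts_factor (p q : seq step) : Prop :=
  exists a f b : seq step, p = a ++ b /\ q = a ++ f ++ b.

(* index_iota m n enumerates m <= i < n. *)
Definition Omega_steady : succession_rule (nat * nat)%type :=
  SuccessionRule (0, 2) (fun l => let: (h, k) := l in
    [seq (h + k + 1 - i, i) | i <- index_iota 2 k.+1] ++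
    [seq (0, i) | i <- index_iota k.+1 (h + k + 2)]).

(* Main.v *)
Require Import Defs.
From mathcomp Require Import all_boot all_order all_algebra.
From mathcomp Require Import zify.

Set Implicit Arguments.
Unset Strict Implicit.
Unset Printing Implicit Defensive.

(** Say that a lattice point lies at depth t when it is on the line
    y = x - 2t.  A step U keeps the depth, D increases it by 1 and W decreases
    it by 1.  Since WD and DW are forbidden, the steps between two consecutive
    U are all D or all W, so a steady path is determined by the depths
    e_1, ..., e_n of its up steps; it ends with D steps from depth e_n down to
    depth n on the x-axis.  In these terms:
    - the cone condition becomes 0 <= e_i < i;
    - a factor UU or WU ending with the i-th up step occurs exactly when
      e_i <= e_(i-1) (a weak descent), and S1 and S2 together say that e_j
      never again drops below such an e_i.

    Let the floor of the path be the last weak descent bottom (0 if there is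
    none); bottoms never decrease, so it is the only active lower bound.
    Hence the sequences of length n+1 extending a given e are those obtained by
    appending any a with floor <= a <= n.  Taking these extensions as children
    gives a generating tree, the parent of a path being obtained by forgetting
    its last up step.

    With h = e_n - floor and k = n - e_n + 1, a child with a > e_n keeps the
    floor and has label (h + k + 1 - i, i) for i = n + 2 - a, which ranges over
    2..k; a child with a <= e_n has floor a, hence label (0, i) with the same i,
    now ranging over k+1..h+k+1.  This is the rule [Omega_steady].

    The translation is [steady_pathP], the label count is [perm_labels].
    Sequences e are stored in reverse order, the last value being the head, so
    that appending a value is a cons. *)

(** * Depth of a path and prefix-wise form of steadiness *)

Definition ups (p : seq step) : nat := count_mem U p.

Definition depth (p : seq step) : int :=
  ((count_mem D p)%:Z - (count_mem W p)%:Z)%R.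

Lemma depth_rcons p x :
  depth (rcons p x) =
  (depth p + match x with U => 0 | D => 1 | W => -1 end)%R.
Proof. by rewrite /depth -cats1 !count_cat; case: x => /=; lia. Qed.

Lemma ups_rcons p x : ups (rcons p x) = (x == U) + ups p.
Proof. by rewrite /ups -cats1 count_cat /= addn0 addnC. Qed.

Lemma endpointE p :
  endpoint p = ((ups p)%:Z + depth p, (ups p)%:Z - depth p)%R.
Proof.
rewrite /endpoint /ups /depth; elim: p => [|x p IHp]; first by rewrite big_nil.
by rewrite big_cons IHp; case: x => /=; congr (_, _); rewrite /=; lia.
Qed.

Lemma diag_endpoint p : diag (endpoint p) = (- (depth p *+ 2))%R.
Proof. by rewrite endpointE /diag /=; lia. Qed.

Lemma in_cone_endpoint p :
  in_cone (endpoint p) = (0 <= depth p <= (ups p)%:Z)%R.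
Proof. by rewrite endpointE /in_cone /=; lia. Qed.

(** The up step ending a factor UU or WU starts at the depth reached by the
    first letter of the factor.  Stating S1 and S2 as one upper bound on these
    depths makes them conditions on the end of each prefix. *)
Definition landings_le (p : seq step) (c : int) : Prop :=
  forall a x b, p = a ++ [:: x; U] ++ b -> x != D ->
    (depth (rcons a x) <= c)%R.

(** The default [U] for the last letter of the empty path is harmless because
    the empty path has depth 0, which [c] bounds anyway. *)
Lemma landings_le_rcons p x c : (0 <= c)%R ->
  landings_le (rcons p x) c <->
  landings_le p c /\ (x = U -> last U p != D -> (depth p <= c)%R).
Proof.
move=> c_ge0; split=> [px_c|[p_c xU_c] a y b].
  split=> [a y b def_p yD|xU].
    by apply: (px_c a y (rcons b x)) => //; rewrite def_p rcons_cat.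
  move: px_c; rewrite xU; case/lastP: p => [|p y] px_c //.
  rewrite last_rcons => yD; apply: (px_c p y [::]) => //.
  by rewrite -!cats1 -catA.
case/lastP: b => [|b z].
  rewrite cats0 -[a ++ _]/(a ++ [:: y] ++ [:: U]) catA !cats1.
  case/rcons_inj=> def_p xU yD; rewrite -def_p.
  by apply: xU_c; rewrite // def_p last_rcons.
by rewrite -!rcons_cat => /rcons_inj[def_p _]; apply: p_c def_p.
Qed.

Record admissible (p : seq step) : Prop := Admissible {
  admissible_depth : (0 <= depth p <= (ups p)%:Z)%R;
  admissible_noWD : ~~ suffix [:: W; D] p;
  admissible_noDW : ~~ suffix [:: D; W] p;
  admissible_landings : landings_le p (depth p)
}.

Definition prefix_admissible (p : seq step) : Prop :=
  forall q, prefix q p -> admissible q.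

Lemma prefix_admissible_rcons p x :
  prefix_admissible (rcons p x) <->
  prefix_admissible p /\ admissible (rcons p x).
Proof.
split=> [px_adm|[p_adm px_adm] q].
  split=> [q qp|]; apply: px_adm; last exact: prefix_refl.
  exact: prefix_trans qp (prefix_rcons _ _).
case/prefixP=> r; case/lastP: r => [|r z].
  by rewrite cats0 => <-.
rewrite -rcons_cat => /rcons_inj[def_p _]; apply: p_adm.
by rewrite def_p prefix_prefix.
Qed.

Lemma infix_suffix (f p : seq step) :
  infix f p -> exists2 q, prefix q p & suffix f q.
Proof.
case/infixP=> a [b ->]; exists (a ++ f); last exact: suffix_suffix.
by rewrite catA prefix_prefix.
Qed.

(** Every clause of steadiness except the endpoint is a condition tested at the
    end of each prefix, so it can be checked one step at a time. *)
Lemma steady_pathE n p :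
  steady_path n p <->
  [/\ 0 < n, ups p = n, depth p = n & prefix_admissible p].
Proof.
split=> [[n_gt0 end_p conf noWD noDW s1 s2]|[n_gt0 upsn depthn adm]].
  move: end_p; rewrite endpointE => -[endx endy].
  split=> //; try lia.
  move=> q qp; split.
  - by rewrite -in_cone_endpoint; apply: conf.
  - apply: contra noWD => sq; apply: infix_trans (prefixW qp).
    exact: suffixW.
  - apply: contra noDW => sq; apply: infix_trans (prefixW qp).
    exact: suffixW.
  (* A factor xU of the prefix [q] is one of [p]; apply S1 or S2 to it, at the
     point where [q] ends. *)
  case/prefixP: qp => r def_p a x b def_q; rewrite {}def_q -!catA in def_p *.
  have b_r : prefix b (b ++ r) by exact: prefix_prefix.
  case: x def_p => // def_p _.
    have := s1 _ _ def_p _ b_r; rewrite !diag_endpoint depth_rcons -catA; lia.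
  have := s2 _ _ def_p _ b_r; rewrite !diag_endpoint cats1 -catA; lia.
have landing a x b q : p = a ++ [:: x; U] ++ b -> x != D -> prefix q b ->
    (depth (rcons a x) <= depth ((a ++ [:: x; U]) ++ q))%R.
  move=> def_p xD qb; have [r def_b] := prefixP qb.
  have /adm[_ _ _] : prefix ((a ++ [:: x; U]) ++ q) p.
    by rewrite def_p def_b !catA prefix_prefix.
  by apply=> //; rewrite -catA.
split=> //.
- by rewrite endpointE upsn depthn; congr (_, _); lia.
- by move=> q /adm[]; rewrite in_cone_endpoint.
- by apply/negP=> /infix_suffix[q /adm[_ noWD _ _]]; apply/negP.
- by apply/negP=> /infix_suffix[q /adm[_ _ noDW _]]; apply/negP.
- move=> a b def_p q qb; rewrite !diag_endpoint.
  have := landing _ _ _ _ def_p isT qb; rewrite depth_rcons; lia.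
move=> a b def_p q qb; rewrite !diag_endpoint cats1.
have := landing _ _ _ _ def_p isT qb; lia.
Qed.

(** * Paths coded by the depths of their up steps *)

Definition run (i j : nat) : seq step := nseq (j - i) D ++ nseq (i - j) W.

Fixpoint body (s : seq nat) : seq step :=
  if s is a :: s' then rcons (body s' ++ run (head 0 s') a) U else [::].

Definition word (s : seq nat) (m : nat) : seq step :=
  body s ++ run (head 0 s) m.

Definition path_of (s : seq nat) : seq step := word s (size s).

Lemma word_U s m : word (m :: s) m = rcons (word s m) U.
Proof. by rewrite /word /= /run subnn cats0. Qed.

Lemma word_D s m : head 0 s <= m -> word s m.+1 = rcons (word s m) D.
Proof.
move=> hm; rewrite /word /run rcons_cat.
have -> : head 0 s - m.+1 = 0 by lia.
have -> : head 0 s - m = 0 by lia.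
by rewrite !cats0 subSn // -[X in nseq X]addn1 nseqD cats1.
Qed.

Lemma word_W s m : m < head 0 s -> word s m = rcons (word s m.+1) W.
Proof.
move=> hm; rewrite /word /run rcons_cat.
have -> : m.+1 - head 0 s = 0 by lia.
have -> : m - head 0 s = 0 by lia.
have -> : head 0 s - m = (head 0 s - m.+1) + 1 by lia.
by rewrite nseqD cats1.
Qed.

(** From the depth of the last up step, reached by [P0] or [PU], every other
    depth is reached by D steps only or by W steps only. *)
Lemma word_ind (P : seq nat -> nat -> Prop) :
  P [::] 0 ->
  (forall s m, P s m -> P (m :: s) m) ->
  (forall s m, head 0 s <= m -> P s m -> P s m.+1) ->
  (forall s m, m < head 0 s -> P s m.+1 -> P s m) ->
  forall s m, P s m.
Proof.
move=> P0 PU PD PW.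
have runP s : P s (head 0 s) -> forall m, P s m.
  move=> Ps m; have [hm|/ltnW mh] := leqP (head 0 s) m.
    rewrite -(subnKC hm); elim: (m - _) => [|k IHk]; first by rewrite addn0.
    by rewrite addnS; apply: PD IHk; apply: leq_addr.
  rewrite -(subKn mh).
  elim: (head 0 s - m) (leq_subr m (head 0 s)) => [|k IHk] k_le.
    by rewrite subn0.
  apply: PW; first lia.
  by have -> : (head 0 s - k.+1).+1 = head 0 s - k by [lia]; apply: IHk; lia.
by elim=> [|a s IHs]; apply: runP => //=; apply: PU.
Qed.

Lemma depth_word s m : depth (word s m) = m.
Proof.
move: s m; apply: word_ind => [|s m IH|s m hm IH|s m hm IH] //.
- by rewrite word_U depth_rcons IH; lia.
- by rewrite word_D // depth_rcons IH; lia.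
by rewrite word_W // depth_rcons IH; lia.
Qed.

Lemma ups_word s m : ups (word s m) = size s.
Proof.
move: s m; apply: word_ind => [|s m IH|s m hm IH|s m hm IH] //.
- by rewrite word_U ups_rcons IH.
- by rewrite word_D // ups_rcons IH.
by rewrite word_W // ups_rcons IH.
Qed.

Lemma last_word s m :
  last U (word s m) =
  if head 0 s < m then D else if m < head 0 s then W else U.
Proof.
move: s m; apply: word_ind => [|s m IH|s m hm IH|s m hm IH] //.
- by rewrite word_U last_rcons /= ltnn.
- by rewrite word_D // last_rcons ltnS hm.
by rewrite word_W // last_rcons hm ltnNge (ltnW hm).
Qed.

(** The state is the list of depths read so far and the current depth.  The
    truncated predecessor is exact on paths that never reach negative depth. *)
Definition read (st : seq nat * nat) (x : step) : seq nat * nat :=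
  match x with
  | U => (st.2 :: st.1, st.2)
  | D => (st.1, st.2.+1)
  | W => (st.1, st.2.-1)
  end.

Definition code (p : seq step) : seq nat := (foldl read ([::], 0) p).1.

Lemma read_word s m : foldl read ([::], 0) (word s m) = (s, m).
Proof.
move: s m; apply: word_ind => [|s m IH|s m hm IH|s m hm IH] //.
- by rewrite word_U foldl_rcons IH.
- by rewrite word_D // foldl_rcons IH.
by rewrite word_W // foldl_rcons IH.
Qed.

Lemma path_ofK : cancel path_of code.
Proof. by move=> s; rewrite /code read_word. Qed.

(** * Valid codes *)

(** The test also succeeds on the one-letter code [:: 0], where there is no
    weak descent, but there the value is 0 in both branches. *)
Fixpoint floor (s : seq nat) : nat :=
  if s is a :: s' then if a <= head 0 s' then a else floor s' else 0.

Fixpoint valid (s : seq nat) : bool :=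
  if s is a :: s' then valid s' && (floor s' <= a <= size s') else true.

Lemma floor_le_head s : valid s -> floor s <= head 0 s.
Proof. by case: s => //= a s /and3P[_ lo _]; case: ifP. Qed.

Lemma head_le_size s : valid s -> head 0 s <= size s.
Proof. by case: s => //= a s /and3P[_ _ hi]; apply: leqW. Qed.

(** Validity makes the weak descent bottoms nondecreasing, so bounding all of
    them amounts to bounding the last one. *)
Lemma landings_word s m (c : int) : valid s -> (0 <= c)%R ->
  landings_le (word s m) c <-> ((floor s)%:Z <= c)%R.
Proof.
move=> + c_ge0; move: s m.
apply: word_ind => [|s m IH|s m hm IH|s m hm IH] vs.
- by split=> // _ [].
- have /= /and3P[vs' lo _] := vs.
  rewrite word_U landings_le_rcons // IH //= last_word depth_word.
  case: ltngtP => mh; split=> [[lo_c]|lo_c].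
  + by [].
  + by split.
  + by apply.
  + by split=> //; lia.
  + by apply.
  + by split=> //; lia.
- rewrite word_D // landings_le_rcons // IH //.
  by split=> [[]|].
rewrite word_W // landings_le_rcons // IH //.
by split=> [[]|].
Qed.

Lemma suffix2_rcons (x y z : step) p : x != U ->
  suffix [:: x; y] (rcons p z) = (last U p == x) && (z == y).
Proof.
move=> xU; rewrite -[[:: x; y]]/(rcons [:: x] y) suffix_rcons andbC eq_sym.
case/lastP: p => [|p w] /=; first by rewrite eq_sym (negPf xU).
rewrite -[[:: x]]/(rcons [::] x) suffix_rcons suffix0s andbT.
by rewrite last_rcons eq_sym.
Qed.

Lemma admissible_word s m : valid s -> floor s <= m <= size s ->
  admissible (word s m).
Proof.
move=> vs /andP[lo hi]; split; rewrite ?depth_word ?ups_word; try lia.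
- case: (ltngtP (head 0 s) m) => [|mh|mh].
  + case: m {lo hi} => // m hm.
    rewrite word_D // suffix2_rcons // last_word.
    by rewrite (_ : m < head 0 s = false); [case: ifP | lia].
  + by rewrite word_W // suffix2_rcons // andbF.
  case: s mh {vs lo hi} => [<- //|a s /= <-].
  by rewrite word_U suffix2_rcons // andbF.
- case: (ltngtP (head 0 s) m) => [|mh|mh].
  + case: m {lo hi} => // m hm.
    by rewrite word_D // suffix2_rcons // andbF.
  + rewrite word_W // suffix2_rcons // last_word.
    by rewrite ltnNge mh /=; case: ifP.
  case: s mh {vs lo hi} => [<- //|a s /= <-].
  by rewrite word_U suffix2_rcons // andbF.
by rewrite landings_word.
Qed.

Lemma prefix_admissible_word s m : valid s -> floor s <= m <= size s ->
  prefix_admissible (word s m).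
Proof.
move: s m; apply: word_ind => [|s m IH|s m hm IH|s m mh IH] vs lo_hi.
- by move=> q; rewrite prefixs0 => /eqP->; apply: (@admissible_word [::] 0).
- rewrite word_U prefix_admissible_rcons -word_U; split.
    by have /= /andP[vs' lo_hi'] := vs; apply: IH.
  exact: admissible_word.
- rewrite word_D // prefix_admissible_rcons -word_D //; split.
    by apply: IH => //; have := floor_le_head vs; lia.
  exact: admissible_word.
rewrite word_W // prefix_admissible_rcons -word_W //; split.
  by apply: IH => //; have := head_le_size vs; lia.
exact: admissible_word.
Qed.

(** Each of the three possible next steps either extends the current run, which
    is forced by the absence of WD and DW, or closes it with an up step. *)
Lemma prefix_admissible_exists p : prefix_admissible p ->
  exists s m, [/\ p = word s m, valid s & floor s <= m <= size s].
Proof.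
elim/last_ind: p => [_|p x IHp]; first by exists [::], 0.
case/prefix_admissible_rcons=> /IHp[s [m [-> vs /andP[lo hi]]]].
case: x => -[]; rewrite depth_rcons ups_rcons depth_word ups_word /=.
- move=> _ _ _ _; exists (m :: s), m.
  rewrite word_U /= vs lo hi leqW //; split=> //.
  by rewrite andbT; case: ifP.
- move=> hi'; rewrite suffix2_rcons // last_word andbT => noWD _ _.
  have hm : head 0 s <= m by rewrite leqNgt; move: noWD; case: ltngtP.
  by exists s, m.+1; rewrite word_D //; split=> //; lia.
move=> /andP[lo' _] _; rewrite suffix2_rcons // last_word andbT => noDW.
have mh : m <= head 0 s by move: noDW; case: ltngtP.
case: m lo hi mh lo' {noDW} => [|m] lo hi mh; first by lia.
rewrite -word_W // => _; have -> : (m.+1%:Z - 1 = m%:Z)%R by lia.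
rewrite landings_word // => lo'.
by exists s, m; split=> //; lia.
Qed.

Lemma steady_pathP n p : steady_path n p <->
  exists s, [/\ p = path_of s, valid s, size s = n & 0 < n].
Proof.
rewrite steady_pathE; split=> [[n_gt0 upsn depthn adm]|[s [-> vs sz n_gt0]]].
  have [s [m [def_p vs _]]] := prefix_admissible_exists adm.
  move: upsn depthn; rewrite def_p ups_word depth_word => sz [mn].
  by exists s; split=> //; rewrite /path_of sz mn.
rewrite /path_of ups_word depth_word sz; split=> //; rewrite -sz.
apply: prefix_admissible_word; rewrite // leqnn andbT.
exact: leq_trans (floor_le_head vs) (head_le_size vs).
Qed.

(** * The generating tree and its labels *)

Definition children (p : seq step) : seq (seq step) :=
  let s := code p in
  [seq path_of (a :: s) | a <- iota (floor s) (size s - floor s).+1].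

Definition label (p : seq step) : nat * nat :=
  let s := code p in (head 0 s - floor s, (size s - head 0 s).+1).

Lemma children_path_of s d : valid s ->
  reflect (exists2 a, d = path_of (a :: s) & valid (a :: s))
          (d \in children (path_of s)).
Proof.
move=> vs; rewrite /children path_ofK.
have lo_hi := leq_trans (floor_le_head vs) (head_le_size vs).
apply: (iffP mapP) => [[a]|[a -> /andP[_ lohi]]].
  by rewrite mem_iota => lohi ->; exists a => //=; rewrite vs; lia.
by exists a => //; rewrite mem_iota; lia.
Qed.

(** If a >= h, the new factor UD is placed inside the final descent, at depth a;
    if a < h, the factor goes back up by W steps to depth a right after the last
    up step and compensates by as many D steps after its own UD.  With truncated
    subtraction both cases have the same form. *)
Lemma inserts_factor_path_of a s : head 0 s <= size s -> a <= size s ->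
  inserts_factor (path_of s) (path_of (a :: s)).
Proof.
move=> hn an; set h := head 0 s.
exists (body s ++ nseq (a - h) D), (nseq (h - a) W ++ U :: nseq (h - a).+1 D).
exists (nseq (size s - maxn a h) D); split.
  rewrite /path_of /word /run -/h.
  have -> : h - size s = 0 by lia.
  rewrite cats0 -catA -nseqD; congr (_ ++ nseq _ _); lia.
rewrite /path_of /word /run -/h /=.
have -> : a - (size s).+1 = 0 by lia.
rewrite -/h cats0 cat_rcons -!catA; congr (_ ++ (_ ++ (_ ++ _))).
rewrite -[RHS]/(U :: (nseq (h - a).+1 D ++ nseq (size s - maxn a h) D)) -nseqD.
by congr (_ :: nseq _ _); lia.
Qed.

Lemma perm_map_subn_iota c m n r : m + n + r = c.+1 ->
  perm_eq [seq c - a | a <- iota m n] (iota r n).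
Proof.
move=> def_c; apply: uniq_perm; rewrite ?iota_uniq //.
  rewrite map_inj_in_uniq ?iota_uniq // => a b; rewrite !mem_iota; lia.
move=> i; rewrite mem_iota; apply/mapP/idP=> [[a]|i_in].
  by rewrite mem_iota => a_in ->; lia.
by exists (c - i); rewrite ?mem_iota; lia.
Qed.

(** The substitution i = n + 2 - a turns the two ranges of appended depths into
    the two ranges of the rule. *)
Lemma perm_labels s : valid s ->
  perm_eq [seq label d | d <- children (path_of s)]
          (productions Omega_steady (label (path_of s))).
Proof.
move=> vs; have lo_h := floor_le_head vs; have h_hi := head_le_size vs.
rewrite /children /label path_ofK -map_comp.
set h := head 0 s in lo_h h_hi *; set l := floor s in lo_h *.
set n := size s in h_hi *.
rewrite (eq_map (g := fun a =>
  (a - (if a <= h then a else l), (n.+1 - a).+1))); last first.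
  by move=> a; rewrite /= path_ofK.
rewrite (_ : (n - l).+1 = (h - l).+1 + (n - h)); last by lia.
rewrite iotaD map_cat perm_catC [productions _ _]/=; apply: perm_cat.
  (* Depths above [h]: no weak descent, the floor stays [l]. *)
  rewrite (_ : map _ _ = [seq (h - l + (n - h).+1 + 1 - i, i) |
      i <- [seq n.+2 - a | a <- iota (l + (h - l).+1) (n - h)]]).
    apply: perm_map; rewrite /index_iota.
    by rewrite !subSS subn0; apply: perm_map_subn_iota; lia.
  rewrite -map_comp; apply/eq_in_map => a; rewrite mem_iota => a_in /=.
  rewrite leqNgt (_ : h < a) /=; last by lia.
  by congr (_, _); lia.
(* Depths from [l] to [h]: the new depth becomes the floor. *)
rewrite (_ : map _ _ = [seq (0, i) |
    i <- [seq n.+2 - a | a <- iota l (h - l).+1]]).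
  apply: perm_map; rewrite /index_iota.
  have -> : h - l + (n - h).+1 + 2 - (n - h).+2 = (h - l).+1 by lia.
  by apply: perm_map_subn_iota; lia.
rewrite -map_comp; apply/eq_in_map => a; rewrite mem_iota => a_in /=.
rewrite (_ : a <= h) /=; last by lia.
by congr (_, _); lia.
Qed.

Lemma steady_path_class : combinatorial_class steady_path.
Proof.
split.
- by move=> n c [].
- move=> m n c /steady_pathE[_ <- _ _] /steady_pathE[_ <- _ _] //.
(* A valid code of length n has all its values below n. *)
- move=> n; exists [seq path_of s | s <- iter n (fun ss =>
    [seq a :: s | a <- iota 0 n, s <- ss]) [:: [::]]].
  move=> c /steady_pathP[s [-> vs sz _]]; apply: map_f.
  have : size s <= n by rewrite sz.
  rewrite -{2}sz; elim: s vs {sz} => //= a s IHs /andP[vs lohi] sn.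
  by apply: allpairs_f; rewrite ?mem_iota ?IHs //; lia.
exists (path_of [:: 0]); split; first by apply/steady_pathP; exists [:: 0].
by move=> c /steady_pathP[[|a [|b s]] [-> //= + _ _]]; case: a.
Qed.

Lemma steady_path_generating_tree :
  generating_tree steady_path inserts_factor (path_of [:: 0]) children.
Proof.
split.
(* The constant code 0, whose path is a power of U followed by one of D, shows
   that there are paths of every size. *)
- move=> n; exists n.+1, (path_of (nseq n.+1 0)); split=> //.
  apply/steady_pathP; exists (nseq n.+1 0); rewrite size_nseq; split=> //.
  have: floor (nseq n.+1 0) = 0 by [].
  elim: n => //= n IHn _; by rewrite IHn.
- by apply/steady_pathP; exists [:: 0].
- move=> n c _; rewrite map_inj_uniq ?iota_uniq // => a b.
  by move/(can_inj path_ofK) => [].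
- move=> n c d /steady_pathP[s [-> vs sz _]] /(children_path_of _ vs)[a -> vas].
  split; first by apply/steady_pathP; exists (a :: s); split=> //=; rewrite sz.
  by apply: inserts_factor_path_of; [apply: head_le_size|case/and3P: vas].
move=> n d /steady_pathP[[|a s] [-> vas <- // _]] d_root.
have vs : valid s by case/andP: vas.
exists (path_of s); split.
  split; last by apply/(children_path_of _ vs); exists a.
  exists (size s); apply/steady_pathP; exists s; split=> //.
  by case: s vas d_root {vs} => //; case: a => // _ [].
move=> c [[m /steady_pathP[t [-> vt _ _]]]] /(children_path_of _ vt)[b].
by move/(can_inj path_ofK) => [_ ->].
Qed.

Theorem proposition28 :
  grows_according_to steady_path inserts_factor Omega_steady.
Proof.
split; first exact: steady_path_class.
exists (path_of [:: 0]), children, label; split=> //.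
  exact: steady_path_generating_tree.
by move=> n c /steady_pathP[s [-> vs _ _]]; apply: perm_labels.
Qed.
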